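(* For all integers $n\ge k\ge 1$, \[ \alpha[J_{\pm}(n,k,k-1)] = 2^k\,\alpha[J(n,k,k-1)]. \]
   Context: For integers $n\ge k\ge 1$ and $t$, $J(n,k,t)$ denotes the graph whose vertex set consists of all vectors in $\{0,1\}^n$ with exactly $k$ nonzero coordinates, two vertices being joined by an edge if and only if their scalar product equals $t$. $J_{\pm}(n,k,t)$ denotes the graph whose vertex set consists of all vectors in $\{-1,0,1\}^n$ with exactly $k$ nonzero coordinates, two vertices being joined by an edge if and only if their scalar product equals $t$. The independence number $\alpha[G]$ of a graph $G$ is the maximum size of an independent set, i.e. a set of vertices no two of which are joined by an edge. *)

(* Defs.v *)
From HB Require Import structures.
From mathcomp Require Import all_boot all_order all_algebra.

Set Implicit Arguments.
Unset Strict Implicit.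
Unset Printing Implicit Defensive.

Import Order.TTheory GRing.Theory Num.Theory.
Local Open Scope ring_scope.

Record sgraph := SGraph {
  vertex :> finType;
  edge : rel vertex;
  edge_sym : symmetric edge;
  edge_irrefl : irreflexive edge }.

Definition independent (G : sgraph) (A : {set G}) : bool :=
  [forall x in A, forall y in A, ~~ edge x y].

Definition independence_number (G : sgraph) : nat :=
  \max_(A : {set G} | independent A) #|A|.

(* [seq_sub S] is the finite type of the integers listed in [S], so that
   ['rV[seq_sub S]_n] is the set S^n seen as a finite type. *)
Definition int_vector (S : seq int) (n : nat) (x : 'rV[seq_sub S]_n) :
  'rV[int]_n := map_mx val x.

Definition scalar_product (n : nat) (u v : 'rV[int]_n) : int :=
  \sum_(i < n) u 0 i * v 0 i.

Definition has_weight (S : seq int) (n k : nat) (x : 'rV[seq_sub S]_n) : bool :=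
  #|[set i : 'I_n | int_vector x 0 i != 0]| == k.

Definition weight_vector (S : seq int) (n k : nat) : finType :=
  {x : 'rV[seq_sub S]_n | has_weight k x}.

(* The condition [x != y] only matters for [t] equal to the squared norm of a
   vertex (i.e. [t = k] when the entries are in {-1, 0, 1}), where it excludes
   loops. *)
Definition product_edge (S : seq int) (n k : nat) (t : int) :
    rel (weight_vector S n k) :=
  fun x y => (x != y) &&
    (scalar_product (int_vector (val x)) (int_vector (val y)) == t).

Lemma product_edge_sym S n k t : symmetric (@product_edge S n k t).
Proof.
move=> x y; rewrite /product_edge eq_sym; congr (_ && (_ == _)).
by apply: eq_bigr => i _; rewrite mulrC.
Qed.

Lemma product_edge_irrefl S n k t : irreflexive (@product_edge S n k t).
Proof. by move=> x; rewrite /product_edge eqxx. Qed.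

Definition product_graph (S : seq int) (n k : nat) (t : int) : sgraph :=
  SGraph (@product_edge_sym S n k t) (@product_edge_irrefl S n k t).

Definition J (n k : nat) (t : int) : sgraph :=
  product_graph [:: 0; 1] n k t.

Definition Jpm (n k : nat) (t : int) : sgraph :=
  product_graph [:: -1; 0; 1] n k t.

(* Main.v *)
(** Flipping signs by a fixed pattern s in {-1, 1}^n embeds J(n,k,k-1) into
    J_±(n,k,k-1), and taking absolute values maps J_±(n,k,k-1) to J(n,k,k-1)
    preserving edges: the deficit between the scalar product of the absolute
    values and that of the vectors is even, and here at most 1. So preimages of
    independent sets are independent in both directions. Each signed vertex lies
    in the image of exactly 2^(n-k) of the 2^n embeddings, and counting pairs
    (pattern, vertex) turns this into both inequalities. *)
Require Import Defs.
From mathcomp Require Import all_boot all_order all_algebra.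
From mathcomp Require Import zify.

Set Implicit Arguments.
Unset Strict Implicit.

Import Order.TTheory GRing.Theory Num.Theory.
Local Open Scope ring_scope.

Lemma leq_independence_number (G : sgraph) (A : {set G}) :
  independent A -> (#|A| <= independence_number G)%N.
Proof. by move=> indA; rewrite /independence_number (bigD1 A) //= leq_maxl. Qed.

Lemma independence_number_witness (G : sgraph) :
  exists2 A : {set G}, independent A & #|A| = independence_number G.
Proof.
have ind0 : independent (set0 : {set G}) by apply/forall_inP => x; rewrite inE.
have [|A indA eqA] := @eq_bigmax_cond _ (@independent G) (fun A => #|A|).
  by apply/card_gt0P; exists set0.
by exists A.
Qed.

Lemma independent_preimset (G H : sgraph) (f : G -> H) (A : {set H}) :
  (forall x y, edge x y -> edge (f x) (f y)) ->
  independent A -> independent (f @^-1: A).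
Proof.
move=> edge_f /forall_inP indA; apply/forall_inP => x; rewrite inE => Ax.
apply/forall_inP => y; rewrite inE => Ay.
by apply: contra (edge_f x y) _; move/forall_inP: (indA _ Ax); apply.
Qed.

(** Such an [s] is forced to be [B] inside [A] and is free outside: [t] maps to [B :|: t]
    bijectively from the subsets of [~: A]. *)
Lemma card_setI_eq (T : finType) (A B : {set T}) :
  B \subset A -> #|[set s : {set T} | s :&: A == B]| = (2 ^ (#|T| - #|A|))%N.
Proof.
move=> sBA; rewrite -[in RHS](setCK A) -cardsCs -card_powerset.
have inj : {in powerset (~: A) &, injective (fun s => B :|: s)}.
  move=> s t; rewrite !powersetE => /setIidPl ds /setIidPl dt eq_st.
  have BA : B :&: ~: A = set0 by apply/eqP; rewrite setI_eq0 disjoints_subset setCK.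
  by move/(congr1 (fun r => r :&: ~: A)): eq_st; rewrite !setIUl BA !set0U ds dt.
rewrite -(card_in_imset inj); apply: eq_card => s; rewrite inE.
apply/eqP/imsetP => [<-|[t]].
  exists (s :\: A); first by rewrite powersetE setDE subsetIr.
  by rewrite setID.
rewrite powersetE -disjoints_subset -setI_eq0 => /eqP tA ->.
by rewrite setIUl tA setU0; apply/setIidPl.
Qed.

Definition coord (S : seq int) (n k : nat) (x : weight_vector S n k) (i : 'I_n) :
  int := val (val x 0 i).

Lemma coord_inj (S : seq int) n k (x y : weight_vector S n k) :
  coord x =1 coord y -> x = y.
Proof. by move=> eq_xy; apply/val_inj/rowP => i; apply/val_inj/eq_xy. Qed.

Lemma product_edgeE (S : seq int) n k t (x y : weight_vector S n k) :
  product_edge t x y = (x != y) && (\sum_i coord x i * coord y i == t).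
Proof. by congr (_ && (_ == _)); apply: eq_bigr => i _; rewrite !mxE. Qed.

Lemma card_coord_neq0 (S : seq int) n k (x : weight_vector S n k) :
  #|[set i | coord x i != 0]| = k.
Proof.
by rewrite -[RHS](eqP (valP x)); apply: eq_card => i; rewrite !inE mxE.
Qed.

Lemma has_weight_row (S : seq int) n k (f : 'I_n -> seq_sub S) :
  #|[set i | val (f i) != 0]| = k -> has_weight k (\row_i f i).
Proof. by move=> <-; apply/eqP; apply: eq_card => i; rewrite !inE !mxE. Qed.

Lemma sign_mem (b : bool) (a : int) :
  a \in [:: 0; 1] -> (-1) ^+ b * a \in [:: -1; 0; 1].
Proof. by rewrite !inE => /orP[]/eqP->; case: b. Qed.

Lemma norm_mem (a : int) : a \in [:: -1; 0; 1] -> `|a| \in [:: 0; 1].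
Proof. by rewrite !inE => /or3P[]/eqP->. Qed.

Section SignedVectors.
Variables n k : nat.
Local Notation V := (weight_vector [:: 0; 1] n k).
Local Notation Vpm := (weight_vector [:: -1; 0; 1] n k).

Definition sign_row (s : {set 'I_n}) (x : V) : 'rV[seq_sub [:: -1; 0; 1 : int]]_n :=
  \row_i SeqSub (sign_mem (i \in s) (valP (val x 0 i))).

Lemma sign_row_weight s x : has_weight k (sign_row s x).
Proof.
apply: has_weight_row; rewrite -[RHS](card_coord_neq0 x); apply: eq_card => i.
by rewrite !inE /= mulf_eq0 signr_eq0.
Qed.

Definition sign_vertex s x : Vpm := Sub (sign_row s x) (sign_row_weight s x).

Lemma coord_sign s x i : coord (sign_vertex s x) i = (-1) ^+ (i \in s) * coord x i.
Proof. by rewrite /coord /= mxE. Qed.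

Definition norm_row (y : Vpm) : 'rV[seq_sub [:: 0; 1 : int]]_n :=
  \row_i SeqSub (norm_mem (valP (val y 0 i))).

Lemma norm_row_weight y : has_weight k (norm_row y).
Proof.
apply: has_weight_row; rewrite -[RHS](card_coord_neq0 y); apply: eq_card => i.
by rewrite !inE /= normr_eq0.
Qed.

Definition norm_vertex y : V := Sub (norm_row y) (norm_row_weight y).

Lemma coord_norm y i : coord (norm_vertex y) i = `|coord y i|.
Proof. by rewrite /coord /= mxE. Qed.

Lemma coord01 (x : V) i : (coord x i == 0) || (coord x i == 1).
Proof. by have := valP (val x 0 i); rewrite !inE. Qed.

Lemma coordpm (y : Vpm) i : [|| coord y i == -1, coord y i == 0 | coord y i == 1].
Proof. by have := valP (val y 0 i); rewrite !inE. Qed.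

Lemma sign_vertexK s : cancel (sign_vertex s) norm_vertex.
Proof.
move=> x; apply: coord_inj => i; rewrite coord_norm coord_sign normrMsign.
by case/orP: (coord01 x i) => /eqP->.
Qed.

Lemma sum_coord (x : V) : \sum_i coord x i = k%:Z.
Proof.
rewrite -[in RHS](card_coord_neq0 x) -sum1dep_card -natz natr_sum [RHS]big_mkcond.
by apply: eq_bigr => i _; case/orP: (coord01 x i) => /eqP->.
Qed.

(** Both vectors receive the same sign at each coordinate, so the signs cancel in every product;
    distinctness survives because [norm_vertex] undoes the flip. *)
Lemma sign_vertex_edge t s (x y : V) :
  product_edge t x y -> product_edge t (sign_vertex s x) (sign_vertex s y).
Proof.
rewrite !product_edgeE (can_eq (sign_vertexK s)) => /andP[-> /eqP <-].
apply/eqP/eq_bigr => i _.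
by rewrite !coord_sign mulrACA -expr2 sqrr_sign mul1r.
Qed.

Lemma norm_vertex_edge (x y : Vpm) :
  product_edge (k%:Z - 1) x y ->
  product_edge (k%:Z - 1) (norm_vertex x) (norm_vertex y).
Proof.
rewrite !product_edgeE => /andP[_ /eqP sum_xy].
have [d deficit] : exists d : nat,
    \sum_i coord (norm_vertex x) i * coord (norm_vertex y) i =
    \sum_i coord x i * coord y i + d%:Z * 2.
  (* For a, b in {-1, 0, 1}, |a||b| - ab is 2 if ab = -1 and 0 otherwise, so [d] counts the
     coordinates with product -1. *)
  exists (\sum_i (coord x i * coord y i == -1)%R)%N.
  rewrite -natz natr_sum mulr_suml -big_split; apply: eq_bigr => i _.
  rewrite !coord_norm.
  by case/or3P: (coordpm x i) => /eqP->; case/or3P: (coordpm y i) => /eqP->.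
have le_k : \sum_i coord (norm_vertex x) i * coord (norm_vertex y) i <= k%:Z.
  rewrite -(sum_coord (norm_vertex x)); apply: ler_sum => i _.
  case/orP: (coord01 (norm_vertex x) i) => /eqP->;
    by case/orP: (coord01 (norm_vertex y) i) => /eqP->.
(* The new product is k - 1 + 2d and at most k, hence d = 0. *)
apply/andP; split; last by apply/eqP; lia.
(* If the absolute values coincided, their product would be k = k - 1 + 2d, impossible by parity. *)
apply/eqP => eq_xy.
have: \sum_i coord (norm_vertex x) i * coord (norm_vertex y) i = k%:Z.
  rewrite -eq_xy -(sum_coord (norm_vertex x)); apply: eq_bigr => i _.
  by case/orP: (coord01 (norm_vertex x) i) => /eqP->.
by lia.
Qed.

(** The pattern must pick out exactly the negative entries within the support of [y], and is
    arbitrary on the n - k zero coordinates. *)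
Lemma card_sign_patterns (y : Vpm) :
  #|[set s | sign_vertex s (norm_vertex y) == y]| = (2 ^ (n - k))%N.
Proof.
have sub : [set i | coord y i == -1] \subset [set i | coord y i != 0].
  by apply/subsetP => i; rewrite !inE => /eqP->.
have := card_setI_eq sub; rewrite card_coord_neq0 card_ord => <-.
apply: eq_card => s; rewrite !inE; apply/eqP/eqP => [eq_y|/setP eq_s].
  apply/setP => i; rewrite !inE -eq_y coord_sign coord_norm.
  by case: (i \in s); case/or3P: (coordpm y i) => /eqP->.
apply: coord_inj => i; have := eq_s i; rewrite !inE coord_sign coord_norm.
by case: (i \in s); case/or3P: (coordpm y i) => /eqP->.
Qed.

(** Double counting of the pairs (s, y) with [y] in [B] and in the image of [sign_vertex s]. *)
Lemma sum_card_preim_sign (B : {set Vpm}) :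
  (\sum_(s : {set 'I_n}) #|sign_vertex s @^-1: B| = #|B| * 2 ^ (n - k))%N.
Proof.
(* Since [norm_vertex] is a left inverse of [sign_vertex s], the only possible preimage of [y] is
   [norm_vertex y]. *)
transitivity (\sum_(s : {set 'I_n}) \sum_(y in B)
                 (sign_vertex s (norm_vertex y) == y))%N.
  apply: eq_bigr => s _.
  rewrite -(card_imset _ (can_inj (sign_vertexK s))) -big_mkcondr sum1dep_card.
  apply: eq_card => y; rewrite inE; apply/imsetP/andP => [[x]|[By /eqP eq_y]].
    by rewrite inE => Bx ->; rewrite sign_vertexK.
  by exists (norm_vertex y); rewrite ?inE eq_y.
rewrite exchange_big /= -sum_nat_const; apply: eq_bigr => y _.
by rewrite -big_mkcond sum1dep_card card_sign_patterns.
Qed.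

End SignedVectors.

Unset Implicit Arguments.
Set Strict Implicit.

Theorem proposition3 (n k : nat) (hk : (1 <= k)%N) (hkn : (k <= n)%N) :
  independence_number (Jpm n k (k%:Z - 1)) =
    (2 ^ k * independence_number (J n k (k%:Z - 1)))%N.
Proof.
have pow_gt0 : (0 < 2 ^ (n - k))%N by rewrite expn_gt0.
have card_patterns : #|{set 'I_n}| = (2 ^ k * 2 ^ (n - k))%N.
  by rewrite -expnD subnKC // -cardsT -powersetT card_powerset cardsT card_ord.
(* Scaling by 2^(n-k) makes the right side a sum of the constant
   [independence_number (J n k (k%:Z - 1))] over all 2^n sign patterns. *)
apply/eqP; rewrite -(eqn_pmul2r pow_gt0) mulnAC -card_patterns eqn_leq.
apply/andP; split.
  (* Upper bound: each pattern pulls a maximum independent [B] back to an independent set of [J]. *)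
  have [B indB <-] := independence_number_witness (Jpm n k (k%:Z - 1)).
  rewrite -(sum_card_preim_sign) -sum_nat_const.
  apply: leq_sum => s _; apply: leq_independence_number.
  exact: (@independent_preimset (J n k (k%:Z - 1)) (Jpm n k (k%:Z - 1))
    (@sign_vertex n k s) _ (@sign_vertex_edge n k _ s) indB).
(* Lower bound: the preimage of a maximum independent [A] under [norm_vertex] is independent, and
   pulling it back along any pattern recovers all of [A]. *)
have [A indA <-] := independence_number_witness (J n k (k%:Z - 1)).
have := leq_independence_number
  (@independent_preimset (Jpm n k (k%:Z - 1)) (J n k (k%:Z - 1))
    (@norm_vertex n k) _ (@norm_vertex_edge n k) indA).
rewrite -(leq_pmul2r pow_gt0); apply: leq_trans.
rewrite -(sum_card_preim_sign) -sum_nat_const.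
apply: leq_sum => s _; apply/subset_leq_card/subsetP => x Ax.
by rewrite !inE sign_vertexK.
Qed.
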